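(* For all integers $m,n\ge 3$ and $l\ge -1$, $$\frac{1}{(m-1)!(n-1)!}X_{\overline{D}(m,l,n)}=X_{P_{m+l+n}}-\sum_{i=1}^{m-2}\frac{m-i-1}{(m-i)!}X_{K_{m-i}}X_{P_{n+l+i}}-\sum_{j=1}^{n-2}\frac{n-j-1}{(n-j)!}X_{K_{n-j}}X_{P_{m+l+j}}+\sum_{i=1}^{m-2}\sum_{j=1}^{n-2}\frac{(m-i-1)(n-j-1)}{(m-i)!(n-j)!}X_{K_{m-i}}X_{K_{n-j}}X_{P_{l+i+j}}.$$
   Context: All graphs are finite and simple; $P_l$ and $K_n$ denote the path and the complete graph on the indicated number of vertices. For $m,n\ge 3$ and $l\ge 2$, the complete dumbbell graph $\overline{D}(m,l,n)$ consists of disjoint $K_m$, $K_n$ and $P_l$, with one leaf of $P_l$ connected by an edge to one vertex of $K_m$ and the other leaf connected by an edge to one vertex of $K_n$. For $l=1$, the single vertex of $P_1$ is adjacent to one vertex of $K_m$ and to one vertex of $K_n$. For $l=0$, it is $K_m$ and $K_n$ (disjoint) connected by an edge. For $l=-1$, it is $K_m$ and $K_n$ sharing exactly one vertex. The chromatic symmetric function of a graph $G$ with vertices $v_1,\ldots,v_d$ is $X_G=\sum_{\kappa} x_{\kappa(v_1)}\cdots x_{\kappa(v_d)}$, the sum over all proper colourings $\kappa:V(G)\to\mathbb{N}$, with $x_1,x_2,\ldots$ commuting variables. *)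

(* Defs.v *)
From HB Require Import structures.
From mathcomp Require Import all_boot all_order all_algebra finmap multiset.
From mathcomp Require Import boolp.
Set Implicit Arguments.
Unset Strict Implicit.
Unset Printing Implicit Defensive.

Import GRing.Theory.

Local Open Scope fset_scope.
Local Open Scope mset_scope.
Local Open Scope ring_scope.

(** * Formal power series in the variables x_0, x_1, x_2, ...

  A monomial is a finite multiset [a : {mset nat}]: the exponent of x_i is
  [a i], the product of monomials is [a `+` b] and divisibility is [a `<=` b].
  A series is an arbitrary family of coefficients. *)

(* A multiplicity in [a] is at most [size a], so [mem_msubs] holds. *)
Definition msubs (a : {mset nat}) : seq {mset nat} :=
  undup [seq b <- [seq ([fsfun x : finsupp a => val (f x)] : {mset nat})
                  | f : {ffun finsupp a -> 'I_(size a).+1}] | b `<=` a].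

Lemma msubs_uniq a : uniq (msubs a).
Proof. exact: undup_uniq. Qed.

Lemma mem_msubs a b : (b \in msubs a) = (b `<=` a).
Proof.
rewrite mem_undup mem_filter; case ba: (b `<=` a) => //=.
apply/imageP; exists [ffun x : finsupp a => inord (b (val x))] => //.
apply/msetP => x; rewrite fsfun_ffun; case: insubP => [u xa ux|xa] /=.
  rewrite ffunE inordK ux // ltnS (leq_trans (msubsetP ba x)) //.
  by rewrite -count_mem_mset count_size.
move: (msubsetP ba x); move: xa; rewrite msuppE -mset_eq0 => /eqP ->.
by rewrite leqn0 => /eqP.
Qed.

Record fps (R : Type) := Fps { fpscoef :> {mset nat} -> R }.

Section FpsRing.
Variable R : comNzRingType.
Implicit Types f g h : fps R.

HB.instance Definition _ := gen_eqMixin (fps R).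
HB.instance Definition _ := gen_choiceMixin (fps R).

Lemma fpsP f g : (forall a, f a = g a) -> f = g.
Proof. by case: f => f; case: g => g /= fg; congr Fps; apply: funext. Qed.

Definition fps0 : fps R := Fps (fun _ => 0).
Definition fps1 : fps R := Fps (fun a => (a == mset0)%:R).
Definition fpsD f g : fps R := Fps (fun a => f a + g a).
Definition fpsN f : fps R := Fps (fun a => - f a).
Definition fpsZ (c : R) f : fps R := Fps (fun a => c * f a).
Definition fpsM f g : fps R :=
  Fps (fun a => \sum_(b <- msubs a) f b * g (a `\` b)).

Lemma fpsDA : associative fpsD.
Proof. by move=> f g h; apply: fpsP => a /=; rewrite addrA. Qed.
Lemma fpsDC : commutative fpsD.
Proof. by move=> f g; apply: fpsP => a /=; rewrite addrC. Qed.
Lemma fpsD0 : left_id fps0 fpsD.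
Proof. by move=> f; apply: fpsP => a /=; rewrite add0r. Qed.
Lemma fpsDN : left_inverse fps0 fpsN fpsD.
Proof. by move=> f; apply: fpsP => a /=; rewrite addNr. Qed.

HB.instance Definition _ := GRing.isZmodule.Build (fps R) fpsDA fpsDC fpsD0 fpsDN.

Lemma perm_msubsB a : perm_eq (msubs a) [seq a `\` b | b <- msubs a].
Proof.
apply: uniq_perm; first exact: msubs_uniq.
  rewrite map_inj_in_uniq ?msubs_uniq // => b c; rewrite !mem_msubs => ba ca e.
  by rewrite -(msetBBK ba) e msetBBK.
move=> b; rewrite mem_msubs; apply/idP/mapP => [ba|[c _ ->]].
  by exists (a `\` b); rewrite ?msetBBK // mem_msubs subset_msetBLR
    -{1}[a]mset0D msetSD // msub0set.
by rewrite subset_msetBLR -{1}[a]mset0D msetSD // msub0set.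
Qed.

Lemma fpsMC : commutative fpsM.
Proof.
move=> f g; apply: fpsP => a /=; rewrite (perm_big _ (perm_msubsB a)) big_map.
rewrite !(big_seq_cond xpredT).
by apply: eq_bigr => b; rewrite mem_msubs andbT => ba; rewrite msetBBK // mulrC.
Qed.

Lemma perm_msubsD a c : c `<=` a ->
  perm_eq [seq b <- msubs a | c `<=` b] [seq c `+` d | d <- msubs (a `\` c)].
Proof.
move=> ca; apply: uniq_perm; first by rewrite filter_uniq // msubs_uniq.
  by rewrite map_inj_uniq ?msubs_uniq //; apply: can_inj (msetDKB c).
move=> b; rewrite mem_filter mem_msubs; apply/andP/mapP => [[cb ba]|[d]].
  by exists (b `\` c); rewrite ?mem_msubs ?msetSB // msetBDKC.
rewrite mem_msubs => da ->; split; first by rewrite -{1}[c]msetD0 msetDS // msub0set.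
by rewrite -(msetBDKC ca) msetDS.
Qed.

Lemma fpsMA : associative fpsM.
Proof.
move=> f g h; apply: fpsP => a /=.
pose F c b := f c * g (b `\` c) * h (a `\` b).
transitivity (\sum_(c <- msubs a) \sum_(b <- msubs a | c `<=` b) F c b).
  rewrite !(big_seq_cond xpredT); apply: eq_bigr => c.
  rewrite mem_msubs andbT => ca.
  rewrite -[in RHS]big_filter (perm_big _ (perm_msubsD ca)) big_map big_distrr /=.
  by apply: eq_bigr => d _; rewrite /F mulrA msetDKB msetBDA.
rewrite (exchange_big_dep xpredT) //= !(big_seq_cond xpredT).
apply: eq_bigr => b; rewrite mem_msubs andbT => ba.
rewrite big_distrl /= -big_filter; apply: perm_big; apply: uniq_perm.
- by rewrite filter_uniq // msubs_uniq.
- exact: msubs_uniq.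
- move=> c; rewrite mem_filter !mem_msubs; case cb: (c `<=` b) => //=.
  exact: msubset_trans cb ba.
Qed.

Lemma fps1M : left_id fps1 fpsM.
Proof.
move=> f; apply: fpsP => a /=.
rewrite (bigD1_seq mset0) ?msubs_uniq ?mem_msubs ?msub0set //= eqxx mul1r msetB0.
by rewrite big1 ?addr0 // => b /negPf ->; rewrite mul0r.
Qed.

Lemma fpsMDl : left_distributive fpsM fpsD.
Proof.
move=> f g h; apply: fpsP => a /=; rewrite -big_split.
by apply: eq_bigr => b _; rewrite mulrDl.
Qed.

Lemma fps1_neq0 : fps1 != 0.
Proof.
apply/eqP => /(congr1 (fun f : fps R => f mset0)) /= /eqP.
by rewrite eqxx oner_eq0.
Qed.

HB.instance Definition _ := GRing.Zmodule_isComNzRing.Build (fps R)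
  fpsMA fpsMC fps1M fpsMDl fps1_neq0.

Lemma fpsZA c d f : fpsZ c (fpsZ d f) = fpsZ (c * d) f.
Proof. by apply: fpsP => a /=; rewrite mulrA. Qed.
Lemma fpsZ1 : left_id 1 fpsZ.
Proof. by move=> f; apply: fpsP => a /=; rewrite mul1r. Qed.
Lemma fpsZDr : right_distributive fpsZ +%R.
Proof. by move=> c f g; apply: fpsP => a /=; rewrite mulrDr. Qed.
Lemma fpsZDl f : {morph fpsZ^~ f : c d / c + d}.
Proof. by move=> c d; apply: fpsP => a /=; rewrite mulrDl. Qed.

HB.instance Definition _ := GRing.Zmodule_isLmodule.Build R (fps R)
  fpsZA fpsZ1 fpsZDr fpsZDl.

Lemma fpsZAl (c : R) f g : c *: (f * g) = (c *: f) * g.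
Proof.
apply: fpsP => a /=; rewrite big_distrr /=.
by apply: eq_bigr => b _; rewrite mulrA.
Qed.

HB.instance Definition _ := GRing.Lmodule_isLalgebra.Build R (fps R) fpsZAl.
HB.instance Definition _ := GRing.Lalgebra_isComAlgebra.Build R (fps R).

End FpsRing.

(** * Finite simple graphs *)

Record sgraph := SGraph {
  svertex :> finType;
  sedge : rel svertex;
  sedge_sym : symmetric sedge;
  sedge_irr : irreflexive sedge }.

Section Complete.
Variable n : nat.
Definition complete_rel : rel 'I_n := fun i j => i != j.
Lemma complete_sym : symmetric complete_rel.
Proof. by move=> i j; rewrite /complete_rel eq_sym. Qed.
Lemma complete_irr : irreflexive complete_rel.
Proof. by move=> i; rewrite /complete_rel eqxx. Qed.
Definition Kgraph := SGraph complete_sym complete_irr.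
End Complete.

Section Path.
Variable n : nat.
Definition path_rel : rel 'I_n :=
  fun i j => (i.+1 == j :> nat) || (j.+1 == i :> nat).
Lemma path_sym : symmetric path_rel.
Proof. by move=> i j; rewrite /path_rel orbC. Qed.
Lemma path_irr : irreflexive path_rel.
Proof. by move=> i; rewrite /path_rel orbb gtn_eqF. Qed.
Definition Pgraph := SGraph path_sym path_irr.
End Path.

(* Disjoint union of [G] and [H], plus an edge from [x : G] to [y : H]
   whenever [b x y]. *)
Section Link.
Variables (G H : sgraph) (b : G -> H -> bool).
Definition link_rel : rel (G + H)%type := fun u v =>
  match u, v with
  | inl x, inl x' => sedge x x'
  | inr y, inr y' => sedge y y'
  | inl x, inr y | inr y, inl x => b x y
  end.
Lemma link_sym : symmetric link_rel.
Proof. by move=> [x|y] [x'|y'] //=; rewrite sedge_sym. Qed.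
Lemma link_irr : irreflexive link_rel.
Proof. by move=> [x|y] /=; rewrite sedge_irr. Qed.
Definition link := SGraph link_sym link_irr.
End Link.

(* K_m and K_n joined by an edge between their vertices 0. *)
Definition dumbbell0 (m n : nat) : sgraph :=
  @link (Kgraph m) (Kgraph n)
    (fun (x : 'I_m) (y : 'I_n) => (x == 0%N :> nat) && (y == 0%N :> nat)).

(* For 1 <= l: vertex 0 of K_m is adjacent to the first vertex of P_l, and the
   last vertex of P_l (the same one if l = 1) to vertex 0 of K_n. *)
Definition dumbbell_path (m l n : nat) : sgraph :=
  @link (Kgraph m)
    (@link (Pgraph l) (Kgraph n)
       (fun (p : 'I_l) (y : 'I_n) => (p.+1 == l) && (y == 0%N :> nat)))
    (fun (x : 'I_m) (w : 'I_l + 'I_n) =>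
       if w is inl p then (x == 0%N :> nat) && (p == 0%N :> nat) else false).

(* K_m and K_n sharing one vertex: vertex 0 of K_m, together with the n - 1
   further vertices on the right, spans K_n. *)
Definition dumbbell_shared (m n : nat) : sgraph :=
  @link (Kgraph m) (Kgraph n.-1)
    (fun (x : 'I_m) (_ : 'I_n.-1) => x == 0%N :> nat).

(* Only meaningful for -1 <= l; [Negz 0] is -1. *)
Definition dumbbell (m : nat) (l : int) (n : nat) : sgraph :=
  match l with
  | Posz 0 => dumbbell0 m n
  | Posz k => dumbbell_path m k n
  | Negz _ => dumbbell_shared m n
  end.

(** * The chromatic symmetric function *)

Definition proper_col (G : sgraph) (C : eqType) (k : G -> C) : bool :=
  [forall u, forall v, sedge u v ==> (k u != k v)].

(* The monomial x_{k(v_1)} ... x_{k(v_d)}. *)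
Definition col_monomial (G : sgraph) (k : G -> nat) : {mset nat} :=
  seq_mset [seq k v | v : G].

(* The coefficient of a monomial [a] is the number of proper colourings
   [G -> nat] with monomial [a]; such a colouring only uses colours in the
   support of [a], so there are finitely many (see [chromsym_coefE]). *)
Definition chromsym (G : sgraph) : fps rat :=
  Fps (fun a => #|[set k : {ffun G -> finsupp a} |
                    proper_col k && (col_monomial (val \o k) == a)]|%:R).

Lemma chromsym_coefE (G : sgraph) (a : {mset nat}) :
  exists s : seq {ffun G -> nat},
    [/\ uniq s,
        (forall k, (k \in s) = proper_col k && (col_monomial k == a))
      & chromsym G a = (size s)%:R].
Proof.
pose A := [set k : {ffun G -> finsupp a} |
            proper_col k && (col_monomial (val \o k) == a)].
pose ext (k : {ffun G -> finsupp a}) : {ffun G -> nat} := [ffun v => val (k v)].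
have extm k : col_monomial (ext k) = col_monomial (val \o k).
  by congr seq_mset; apply: eq_map => v; rewrite ffunE.
have extp k : proper_col (ext k) = proper_col k.
  by apply: eq_forallb => u; apply: eq_forallb => v; rewrite !ffunE (inj_eq val_inj).
exists [seq ext k | k <- enum A]; split.
- rewrite map_inj_uniq ?enum_uniq // => k k' /ffunP e.
  by apply/ffunP => v; apply: val_inj; have := e v; rewrite !ffunE.
- move=> k; apply/mapP/andP => [[k']|[kp /eqP km]].
    by rewrite mem_enum inE => /andP[kp km] ->; rewrite extp extm.
  have ka v : k v \in finsupp a.
    by rewrite msuppE -km -mset_neq0 mset_seqE -lt0n -has_count has_pred1;
      apply/imageP; exists v.
  pose k' : {ffun G -> finsupp a} := [ffun v => [` ka v]].
  have ek : k = ext k' by apply/ffunP => v; rewrite !ffunE.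
  by exists k' => //; rewrite mem_enum inE -extp -extm -ek kp km eqxx.
- by rewrite size_map -cardE.
Qed.

(* Main.v *)
Require Import Defs.
From mathcomp Require Import perm all_boot all_order all_algebra.
From mathcomp Require Import finmap multiset zify.

(** Let [v] be a vertex of a graph [G], let [N_m(G, v)] be [G] with an m-clique
  all of whose vertices are joined to [v], and let [F_m(G, v)] be [G] with an
  m-clique one of whose vertices is joined to [v].  A proper colouring of the
  disjoint union of [K_m] and [G] gives pairwise different colours to the
  clique, so at most one clique vertex has the colour of [v].  It is therefore
  compatible with all [m] of the possible edges from the clique to [v], or with
  exactly [m - 1] of them.  Summing over the [m] edges gives
    [m * X(F_m) = X(N_m) + (m - 1) * X(K_m) * X(G)],
  which is [clique_cone_recurrence].

  One clique vertex of [F_(m+1)(G, v)] can be read as a pendant vertex [h]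
  attached to [v]; thus [F_(m+1)(G, v) = N_m(G + h, h)]
  ([clique_bridge_pendant]).  Take rooted graphs [G_0, G_1, ...] in which each
  one is the previous one with a pendant vertex at the root, which is the new
  root.  The recurrence then expresses [N_(m+1)(G_t)] by [N_m(G_(t+1))] and
  [K_(m+1) * G_t], and unrolling it gives [clique_cone_expansion]:
    [X(N_m(G_t)) / m! =
       X(G_(t+m)) - sum_(q < m) (m-q-1)/(m-q)! X(K_(m-q)) X(G_(t+q))].

  The right-hand side is an operator applied to the sequence [X(G_t)].  A
  dumbbell is two cliques attached to the ends of a path, so the theorem is this
  expansion used twice: the growing paths give the lollipops, and the lollipops
  with growing tail give the dumbbells.  The operator is linear, and expanding
  the composite of its instances for the two cliques gives the four terms of
  the formula. *)

Set Implicit Arguments.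
Unset Strict Implicit.
Unset Printing Implicit Defensive.

Import GRing.Theory.
Local Open Scope fset_scope.
Local Open Scope mset_scope.
Local Open Scope ring_scope.

(** * Counting colourings *)

(** The palette [S] is arbitrary, [c] naming its colours, so that the
  coefficients of several monomials can be counted with one common palette. *)
Definition colourings (G : sgraph) (S : finType) (c : S -> nat)
    (a : {mset nat}) : {set {ffun G -> S}} :=
  [set k : {ffun G -> S} | proper_col k && (col_monomial (c \o k) == a)].

Lemma chromsymE (G : sgraph) (S : finType) (c : S -> nat) (a : {mset nat}) :
  injective c -> {subset finsupp a <= codom c} ->
  chromsym G a = #|colourings G c a|%:R.
Proof.
move=> c_inj ca; have [s [s_uniq sP ->]] := chromsym_coefE G a; congr _%:R.
pose ext (k : {ffun G -> S}) : {ffun G -> nat} := [ffun v => c (k v)].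
rewrite cardE -(size_map ext); apply/perm_size/uniq_perm => //.
  rewrite map_inj_uniq ?enum_uniq // => k k' /ffunP e.
  by apply/ffunP => v; apply: c_inj; have := e v; rewrite !ffunE.
have ext_mono k : col_monomial (ext k) = col_monomial (c \o k).
  by congr seq_mset; apply: eq_map => v; rewrite ffunE.
have ext_proper k : proper_col (ext k) = proper_col k.
  by apply: eq_forallb => u; apply: eq_forallb => v; rewrite !ffunE (inj_eq c_inj).
move=> k; rewrite sP; apply/andP/mapP => [[kp /eqP km]|[k']]; last first.
  by rewrite mem_enum inE => /andP[kp km] ->; rewrite ext_mono ext_proper.
have kc v : k v \in codom c.
  apply: ca; rewrite msuppE -km -mset_neq0 mset_seqE -lt0n -has_count has_pred1.
  by apply/imageP; exists v.
have ek : k = ext [ffun v => iinv (kc v)].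
  by apply/ffunP => v; rewrite !ffunE f_iinv.
exists [ffun v => iinv (kc v)] => //.
by rewrite mem_enum inE -ext_proper -ext_mono -ek kp km eqxx.
Qed.

(** The colours of a multiple [a] of [b] serve as a palette for [b].  In a
  product of series, the coefficient of [a] is thus a sum of counts of
  colourings that all use the same palette. *)
Lemma chromsymE_sub (G : sgraph) (a b : {mset nat}) : (b `<=` a)%mset ->
  chromsym G b = #|colourings G (val : finsupp a -> nat) b|%:R.
Proof.
move=> ba; apply: chromsymE => [|x xb]; first exact: val_inj.
have xa : x \in finsupp a.
  move: xb; rewrite !msuppE -!mset_neq0 -!lt0n => xb.
  exact: leq_trans xb (msubsetP ba x).
by apply/codomP; exists [` xa]%fset.
Qed.

Lemma chromsym_iso (G H : sgraph) (f : G -> H) :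
  bijective f -> (forall u v, sedge (f u) (f v) = sedge u v) ->
  chromsym G = chromsym H.
Proof.
move=> [g fK gK] f_edge; apply: fpsP => a /=; congr _%:R; apply/esym.
pose pull (k : {ffun H -> finsupp a}) : {ffun G -> finsupp a} :=
  [ffun v => k (f v)].
have pull_bij : bijective pull.
  exists (fun k : {ffun G -> finsupp a} =>
    [ffun w => k (g w)] : {ffun H -> finsupp a}) => k; apply/ffunP => v.
    by rewrite !ffunE gK.
  by rewrite !ffunE fK.
rewrite -(on_card_preimset (onW_bij _ pull_bij)).
apply: eq_card => k; rewrite !inE; congr (_ && (_ == a)).
  apply/forallP/forallP => kP.
    by move=> u; apply/forallP=> v; rewrite !ffunE -f_edge; move/forallP: (kP (f u)).
  move=> u; apply/forallP=> v; move/forallP: (kP (g u)) => /(_ (g v)).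
  by rewrite !ffunE -f_edge !gK.
apply/eq_seq_msetP => /=.
rewrite (_ : [seq _ | v : G] = [seq (val \o k) w | w <- [seq f v | v : G]]).
  apply: perm_map; apply: uniq_perm; rewrite ?enum_uniq //.
    by rewrite map_inj_uniq ?enum_uniq //; apply: can_inj fK.
  move=> w; rewrite mem_enum; apply/esym/mapP; exists (g w); rewrite ?gK //.
  by rewrite mem_enum.
by rewrite -map_comp; apply: eq_map => v /=; rewrite ffunE.
Qed.

(** * Disjoint unions and products *)

Definition disjoint_union (G H : sgraph) := @link G H (fun _ _ => false).

Lemma col_monomial_sum (G H : sgraph) b (k : (G + H)%type -> nat) :
  col_monomial (G := @link G H b) k =
  col_monomial (k \o inl) `+` col_monomial (k \o inr).
Proof.
apply/msetP => x; rewrite msetE2 !mset_seqE -count_cat; apply/permP.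
rewrite /image_mem (map_comp k inl) (map_comp k inr) -map_cat perm_map //.
apply: uniq_perm; rewrite ?enum_uniq //.
  rewrite cat_uniq !map_inj_uniq ?enum_uniq //=; try by move=> ? ? [].
  rewrite -!enumT !enum_uniq andbT /=.
  by apply/hasPn => _ /mapP[y _ ->]; apply/mapP => -[].
case=> y; rewrite mem_enum mem_cat; apply/esym.
  by rewrite map_f ?mem_enum.
by rewrite orbC map_f ?mem_enum.
Qed.

Lemma proper_col_disjoint (G H : sgraph) (S : eqType) (k : (G + H)%type -> S) :
  proper_col (G := disjoint_union G H) k =
  proper_col (k \o inl) && proper_col (k \o inr).
Proof.
apply/idP/andP => [/forallP kP|[/forallP kG /forallP kH]].
  split; apply/forallP=> u; apply/forallP=> v.
    by move/forallP: (kP (inl u)) => /(_ (inl v)).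
  by move/forallP: (kP (inr u)) => /(_ (inr v)).
apply/forallP=> -[] u; apply/forallP=> -[] v //=.
  by move/forallP: (kG u).
by move/forallP: (kH u).
Qed.

Lemma msubsetD_eq (a b c : {mset nat}) :
  (b `<=` a) && (c == a `\` b) = (b `+` c == a).
Proof.
apply/andP/eqP => [[ba /eqP ->]|<-].
  by apply/msetP => x; rewrite msetE2 msetE2 subnKC //; apply/msubsetP.
split; first by apply/msubsetP => x; rewrite msetE2 leq_addr.
by apply/eqP/msetP => x; rewrite msetE2 msetE2 addKn.
Qed.

(** A colouring of the disjoint union is a pair of independent colourings, and
  its monomial is the product of their monomials; sorting the pairs by the
  monomial [b] of the first component gives the convolution that defines the
  product of series. *)
Lemma chromsym_disjoint (G H : sgraph) :
  chromsym (disjoint_union G H) = chromsym G * chromsym H.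
Proof.
apply: fpsP => a.
pose K (J : sgraph) := {ffun J -> finsupp a}.
pose mono (J : sgraph) (k : K J) := col_monomial (val \o k).
pose split (k : K (disjoint_union G H)) : K G * K H :=
  ([ffun x => k (inl x)], [ffun y => k (inr y)]).
pose glue (p : K G * K H) : K (disjoint_union G H) :=
  [ffun z => match z with inl x => p.1 x | inr y => p.2 y end].
have glueK : cancel glue split.
  by case=> k1 k2; congr pair; apply/ffunP => z; rewrite !ffunE.
have splitK : cancel split glue.
  by move=> k; apply/ffunP => -[] z; rewrite !ffunE.
transitivity (\sum_(p : K G * K H)
   ((proper_col p.1 && proper_col p.2) && (mono G p.1 `+` mono H p.2 == a))%:R : rat).
  rewrite /= -sum1_card natr_sum big_mkcond /=.
  rewrite (reindex glue) /=; last by exists split => p _; rewrite ?glueK ?splitK.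
  apply: eq_bigr => -[k1 k2] _; rewrite inE proper_col_disjoint col_monomial_sum.
  have mG : col_monomial ((val \o glue (k1, k2)) \o inl) = mono G k1.
    by congr seq_mset; apply: eq_map => x; rewrite /= ffunE.
  have mH : col_monomial ((val \o glue (k1, k2)) \o inr) = mono H k2.
    by congr seq_mset; apply: eq_map => y; rewrite /= ffunE.
  have pG : proper_col (glue (k1, k2) \o inl) = proper_col k1.
    by apply: eq_forallb => u; apply: eq_forallb => v; rewrite /= !ffunE.
  have pH : proper_col (glue (k1, k2) \o inr) = proper_col k2.
    by apply: eq_forallb => u; apply: eq_forallb => v; rewrite /= !ffunE.
  rewrite mG mH pG pH.
  by case: ifP.
rewrite -(pair_bigA _ (fun (k1 : K G) (k2 : K H) =>
  ((proper_col k1 && proper_col k2) && (mono G k1 `+` mono H k2 == a))%:R : rat)) /=.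
transitivity (\sum_(b <- msubs a) \sum_(k1 : K G) \sum_(k2 : K H)
  ((proper_col k1 && (mono G k1 == b))%:R *
   (proper_col k2 && (mono H k2 == a `\` b))%:R : rat)).
  (* For fixed colourings only [b = mono G k1] contributes, and it does so
     exactly when the two monomials multiply to [a]. *)
  rewrite [RHS]exchange_big /=; apply: eq_bigr => k1 _.
  rewrite [RHS]exchange_big /=; apply: eq_bigr => k2 _.
  rewrite -msubsetD_eq -mem_msubs; case: (boolP (mono G k1 \in _)) => [k1a|k1a].
    rewrite (bigD1_seq (mono G k1)) ?msubs_uniq //= eqxx andbT big1 ?addr0.
      by rewrite -natrM mulnb -!andbA.
    by move=> b /negPf bk; rewrite eq_sym bk andbF mul0r.
  rewrite andbF big_seq big1 // => b ba.
  by case: eqP k1a => [->|]; rewrite ?ba // andbF mul0r.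
rewrite -[RHS]/(\sum_(b <- msubs a) chromsym G b * chromsym H (a `\` b)).
rewrite !big_seq; apply: eq_bigr => b; rewrite mem_msubs => ba.
rewrite (chromsymE_sub G ba) (chromsymE_sub H (msubsetDl _ _)).
have countE (J : sgraph) c : #|colourings J (val : finsupp a -> nat) c|%:R =
    \sum_(k : K J) (proper_col k && (mono J k == c))%:R :> rat.
  rewrite -sum1_card natr_sum big_mkcond.
  by apply: eq_bigr => k _; rewrite inE; case: ifP.
rewrite !countE mulr_suml; apply: eq_bigr => k1 _.
by rewrite mulr_sumr.
Qed.

(** * Attaching a clique at a vertex *)

Lemma proper_col_link (G H : sgraph) (b : G -> H -> bool) (S : eqType)
    (k : (G + H)%type -> S) :
  proper_col (G := @link G H b) k =
  proper_col (G := disjoint_union G H) k &&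
  [forall x, forall y, b x y ==> (k (inl x) != k (inr y))].
Proof.
apply/idP/andP => [/forallP kP|[/forallP kP /forallP kb]].
  split; apply/forallP=> u; apply/forallP=> v.
    by case: u v => u [] v //=; [move/forallP: (kP (inl u)) => /(_ (inl v))
      | move/forallP: (kP (inr u)) => /(_ (inr v))].
  by move/forallP: (kP (inl u)) => /(_ (inr v)).
apply/forallP=> -[] u; apply/forallP=> -[] v /=.
- by move/forallP: (kP (inl u)) => /(_ (inl v)).
- by move/forallP: (kb u).
- by rewrite eq_sym; move/forallP: (kb v).
- by move/forallP: (kP (inr u)) => /(_ (inr v)).
Qed.

Lemma proper_col_complete m (S : eqType) (k : 'I_m -> S) :
  proper_col (G := Kgraph m) k -> injective k.
Proof.
move=> /forallP kP x y kxy; apply/eqP; apply: contraT => xy.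
by move/forallP: (kP x) => /(_ y); rewrite /= /complete_rel xy kxy eqxx.
Qed.

(** Together with [v], the clique spans a complete graph on [m.+1] vertices. *)
Definition clique_cone m (G : sgraph) (v : G) :=
  @link (Kgraph m) G (fun _ y => y == v).

Definition clique_bridge m (x : 'I_m) (G : sgraph) (v : G) :=
  @link (Kgraph m) G (fun x' y => (x' == x) && (y == v)).

Lemma clique_bridge_transfer m (x0 x : 'I_m) (G : sgraph) (v : G) :
  chromsym (clique_bridge x v) = chromsym (clique_bridge x0 v).
Proof.
pose f (z : 'I_m + G) : 'I_m + G := if z is inl y then inl (tperm x x0 y) else z.
apply: (@chromsym_iso (clique_bridge x v) (clique_bridge x0 v) f).
  by exists f => -[y|y] //=; rewrite tpermK.
have tpx y : (tperm x x0 y == x0) = (y == x).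
  by rewrite -(inj_eq (@perm_inj _ (tperm x x0)) y x) tpermL.
by move=> [y|y] [z|z] //=; rewrite ?tpx // /complete_rel (inj_eq perm_inj).
Qed.

(** Double counting of the pairs of a proper colouring of the disjoint union and
  a clique vertex whose colour differs from that of [v].  Only the [x0] bridge
  occurs because the clique is symmetric in its vertices. *)
Lemma clique_cone_recurrence m (x0 : 'I_m) (G : sgraph) (v : G) :
  chromsym (clique_cone m v) =
  m%:R *: chromsym (clique_bridge x0 v)
  - m.-1%:R *: (chromsym (Kgraph m) * chromsym G).
Proof.
apply/eqP; rewrite eq_sym subr_eq -chromsym_disjoint; apply/eqP.
transitivity (\sum_(x < m) chromsym (clique_bridge x v)).
  rewrite (eq_bigr _ (fun x _ => clique_bridge_transfer x0 x v)).
  by rewrite sumr_const card_ord scaler_nat.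
apply: fpsP => a.
have fps_sum (F : 'I_m -> fps rat) : (\sum_x F x) a = \sum_x F x a.
  by elim/big_rec2: _ => // i y1 y2 _ <-.
rewrite fps_sum /= -natrM -natrD -natr_sum; congr _%:R.
pose E := [set k : {ffun 'I_m + G -> finsupp a} |
  proper_col (G := disjoint_union (Kgraph m) G) k &&
  (col_monomial (G := disjoint_union (Kgraph m) G) (val \o k) == a)].
transitivity (\sum_(k in E) \sum_(x < m) (k (inl x) != k (inr v)))%N.
  rewrite exchange_big /=; apply: eq_bigr => x _.
  rewrite -sum1_card big_mkcond [RHS]big_mkcond; apply: eq_bigr => k _.
  rewrite !inE proper_col_link andbAC.
  rewrite (_ : [forall x1, _] = (k (inl x) != k (inr v))).
    by case: (k (inl x) != _); rewrite ?andbT ?andbF //; case: ifP.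
  apply/forallP/idP => [/(_ x)/forallP/(_ v)|kxv x']; first by rewrite !eqxx.
  by apply/forallP => y; apply/implyP => /andP[/eqP -> /eqP ->].
transitivity (\sum_(k in E) ([forall x : 'I_m, k (inl x) != k (inr v)] + m.-1))%N.
  apply: eq_bigr => k; rewrite inE proper_col_disjoint => /andP[/andP[kp _] _].
  (* The clique colours are distinct, so the colour of [v] occurs on at most one
     clique vertex. *)
  have k_inj := proper_col_complete kp.
  case: (boolP [forall x, _]) => [/forallP k_new|].
    rewrite (eq_bigr _ (fun x _ => congr1 nat_of_bool (k_new x))) /=.
    by rewrite sum1_card card_ord add1n prednK //; case: (m) x0 => -[].
  rewrite negb_forall => /existsP[x]; rewrite negbK => /eqP kx.
  rewrite (bigD1 x) //= kx eqxx add0n (eq_bigr (fun=> 1%N)).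
    by rewrite sum1_card cardC1 card_ord.
  by move=> y /eqP yx; rewrite -kx; case: eqP => // e; case: yx; apply: k_inj e.
rewrite big_split /= sum_nat_const mulnC; congr (_ + _)%N.
rewrite -sum1_card big_mkcond [RHS]big_mkcond; apply: eq_bigr => k _.
rewrite !inE (@proper_col_link (Kgraph m) G (fun _ y => y == v)) andbAC.
rewrite (_ : [forall x, forall y, _] = [forall x : 'I_m, k (inl x) != k (inr v)]).
  case: [forall x : 'I_m, k (inl x) != k (inr v)]; rewrite ?andbT ?andbF //.
  by case: ifP.
apply: eq_forallb => x; apply/forallP/idP => [/(_ v)|kxv y]; first by rewrite eqxx.
by apply/implyP => /eqP ->.
Qed.

(** * Moving the root along a pendant vertex *)

(** [H] is [G] with a new vertex [h] whose only neighbour is [v]; the map [e]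
  identifies [G] with [H] deprived of [h]. *)
Definition pendant_extension (G : sgraph) (v : G) (H : sgraph) (h : H) :=
  exists e : G -> H, [/\ bijective (oapp e h),
    forall x y, sedge (e x) (e y) = sedge x y &
    forall y, sedge h (e y) = (y == v)].

(** The clique vertex that carries the bridge plays the role of the pendant vertex
  [h]: it is adjacent to [v] and to the [m] other clique vertices. *)
Lemma clique_bridge_pendant m (G H : sgraph) (v : G) (h : H) :
  pendant_extension v h ->
  chromsym (clique_bridge (@ord0 m) v) = chromsym (clique_cone m h).
Proof.
move=> [e [[g eK gK] e_edge h_edge]].
have gh : g h = None by rewrite -(eK None).
have ge y : g (e y) = Some y by rewrite -(eK (Some y)).
have eh y : (e y == h) = false by apply/eqP => /(congr1 g); rewrite ge gh.
pose f (z : clique_bridge (@ord0 m) v) : clique_cone m h :=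
  match z with
  | inl x => oapp inl (inr h) (unlift ord0 x)
  | inr y => inr (e y)
  end.
apply: (@chromsym_iso _ _ f).
  pose f' (z : 'I_m + H) : 'I_m.+1 + G :=
    match z with
    | inl x => inl (lift ord0 x)
    | inr y => oapp inr (inl ord0) (g y)
    end.
  exists f' => -[x|y] /=; rewrite ?liftK ?ge //.
    by case: unliftP => [j|] -> //=; rewrite gh.
  by have := gK y; case: (g y) => [z|] /= <- //; rewrite unlift_none.
have edge0 : sedge h h = false by apply: sedge_irr.
have edgeC y : sedge (e y) h = (y == v) by rewrite sedge_sym h_edge.
move=> [x|x] [y|y] /=.
- case: (unliftP ord0 x) => [i|] ->; case: (unliftP ord0 y) => [j|] -> /=.
  + by rewrite /complete_rel; congr (~~ _); apply/esym/(inj_eq lift_inj).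
  + by rewrite eqxx.
  + by rewrite eqxx.
  + by rewrite /complete_rel eqxx edge0.
- by case: (unliftP ord0 x) => [i|] -> /=; rewrite ?eh ?h_edge ?eqxx.
- by case: (unliftP ord0 y) => [i|] -> /=; rewrite ?eh ?edgeC ?eqxx.
- exact: e_edge.
Qed.

Lemma clique_cone0 (G : sgraph) (v : G) :
  chromsym (clique_cone 0 v) = chromsym G.
Proof.
apply/esym; apply: (@chromsym_iso G (clique_cone 0 v) inr) => //.
by exists (fun z : 'I_0 + G => if z is inr y then y else v) => [|[[]|]].
Qed.

(** The operator on sequences of series by which the attachment of a clique acts.
  The term for [q = m.-1] vanishes; keeping it makes the formula valid for
  [m = 0] and lets the sum unroll uniformly. *)
Definition clique_transform (p : nat -> fps rat) (m t : nat) : fps rat :=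
  p (t + m)%N - \sum_(0 <= q < m)
    ((m - q).-1%:R / ((m - q)`!)%:R) *: (chromsym (Kgraph (m - q)) * p (t + q)%N).

Lemma clique_transformZ c p m t :
  c *: clique_transform p m t = clique_transform (fun s => c *: p s) m t.
Proof.
rewrite /clique_transform scalerBr scaler_sumr; congr (_ - _).
by apply: eq_bigr => q _; rewrite -scalerAr !scalerA mulrC.
Qed.

(** The same operator indexed by the order [m.+1] of the clique that contains the
  root, with [i = q.+1] and without the zero term. *)
Lemma clique_transformE p m t :
  clique_transform p m t =
  p (t + m)%N - \sum_(1 <= i < m)
    ((m.+1 - i - 1)%N%:R / ((m.+1 - i)`!)%:R) *:
      (chromsym (Kgraph (m.+1 - i)) * p (t + i.-1)%N).
Proof.
congr (_ - _); case: m => [|m]; first by rewrite !big_geq.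
rewrite big_nat_recr //= subSnn mul0r scale0r addr0 big_add1 /=.
by apply: eq_bigr => q _; rewrite subSS subn1.
Qed.

(** Unrolling the recurrence: one clique vertex at a time becomes a pendant vertex
  of the graph, while each step leaves behind a product [K_(m+1) * G_t]. *)
Lemma clique_cone_expansion (G : nat -> sgraph) (v : forall t, G t) :
  (forall t, pendant_extension (v t) (v t.+1)) ->
  forall m t, (m`!%:R)^-1 *: chromsym (clique_cone m (v t)) =
    clique_transform (fun s => chromsym (G s)) m t.
Proof.
move=> G_ext; elim=> [|m IHm] t; rewrite /clique_transform.
  by rewrite fact0 invr1 scale1r clique_cone0 big_geq // subr0 addn0.
rewrite (clique_cone_recurrence (@ord0 m)) (clique_bridge_pendant m (G_ext t)).
rewrite big_nat_recl // subn0 addn0 opprD addrCA addrC -/(_ - _).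
have -> : chromsym (G (t + m.+1)%N) - \sum_(0 <= q < m)
    ((m.+1 - q.+1).-1%:R / ((m.+1 - q.+1)`!)%:R) *:
      (chromsym (Kgraph (m.+1 - q.+1)) * chromsym (G (t + q.+1)%N)) =
  clique_transform (fun s => chromsym (G s)) m t.+1.
  rewrite /clique_transform addnS; congr (_ - _).
  by apply: eq_bigr => q _; rewrite subSS addnS.
rewrite -IHm scalerBr !scalerA [_^-1 * _]mulrC factS natrM; congr (_ *: _ - _ *: _).
  by rewrite invfM mulrA divff ?mul1r // Num.Theory.pnatr_eq0.
by rewrite mulrC.
Qed.

(** * Paths, lollipops and dumbbells *)

Lemma path_pendant t :
  pendant_extension (@ord_max t : Pgraph t.+1) (@ord_max t.+1 : Pgraph t.+2).
Proof.
exists (lift ord_max : Pgraph t.+1 -> Pgraph t.+2); split.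
- exists (unlift ord_max) => [[x|]|y] /=; rewrite ?liftK ?unlift_none //.
  by case: unliftP.
- by move=> x y; rewrite /= /path_rel !lift_max.
- move=> y; rewrite /= /path_rel lift_max /=.
  by rewrite gtn_eqF // ltnS ltnW.
Qed.

(** A complete graph on [n.+1] vertices with a tail of [t] further vertices: the
  last vertex of the path on [t.+1] vertices belongs to the clique, and its first
  vertex is the free end of the tail. *)
Definition lollipop n t := clique_cone n (@ord_max t : Pgraph t.+1).
Definition lollipop_end n t : lollipop n t := inr ord0.

Lemma lollipop_pendant n t :
  pendant_extension (lollipop_end n t) (lollipop_end n t.+1).
Proof.
pose e (z : lollipop n t) : lollipop n t.+1 :=
  match z with inl x => inl x | inr p => inr (lift ord0 p) end.
exists e; split.
- pose g (z : lollipop n t.+1) : option (lollipop n t) :=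
    match z with inl x => Some (inl x) | inr p => omap inr (unlift ord0 p) end.
  exists g => [[[x|p]|]|[x|p]] /=; rewrite ?liftK ?unlift_none //.
  by case: unliftP => [j|] ->.
- by move=> [x|p] [y|q].
- by move=> [x|p] //; rewrite /= /path_rel orbF eq_sym.
Qed.

Lemma dumbbell_shared_iso m n :
  chromsym (clique_cone m (lollipop_end n 0)) =
  chromsym (dumbbell_shared m.+1 n.+1).
Proof.
pose f (z : 'I_m + ('I_n + 'I_1)) : 'I_m.+1 + 'I_n :=
  match z with
  | inl x => inl (lift ord0 x)
  | inr (inl y) => inr y
  | inr (inr _) => inl ord0
  end.
pose g (z : 'I_m.+1 + 'I_n) : 'I_m + ('I_n + 'I_1) :=
  match z with
  | inl x => oapp inl (inr (inr ord0)) (unlift ord0 x)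
  | inr y => inr (inl y)
  end.
apply: (@chromsym_iso (clique_cone m (lollipop_end n 0))
  (dumbbell_shared m.+1 n.+1) f).
  exists g => [[x|[y|p]]|[x|y]] //=; rewrite ?liftK ?unlift_none ?(ord1 p) //.
  by case: unliftP => [j|] ->.
by move=> [x|[x|p]] [y|[y|q]] //=; rewrite ?(ord1 p) ?(ord1 q).
Qed.

Lemma dumbbell0_iso m n :
  chromsym (clique_bridge (@ord0 m) (lollipop_end n 0)) =
  chromsym (dumbbell0 m.+1 n.+1).
Proof.
pose f (z : 'I_m.+1 + ('I_n + 'I_1)) : 'I_m.+1 + 'I_n.+1 :=
  match z with
  | inl x => inl x
  | inr (inl y) => inr (lift ord0 y)
  | inr (inr _) => inr ord0
  end.
pose g (z : 'I_m.+1 + 'I_n.+1) : 'I_m.+1 + ('I_n + 'I_1) :=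
  match z with
  | inl x => inl x
  | inr y => inr (oapp inl (inr ord0) (unlift ord0 y))
  end.
apply: (@chromsym_iso (clique_bridge (@ord0 m) (lollipop_end n 0))
  (dumbbell0 m.+1 n.+1) f).
  exists g => [[x|[y|p]]|[x|y]] //=; rewrite ?liftK ?unlift_none ?(ord1 p) //.
  by case: unliftP => [j|] ->.
by move=> [x|[x|p]] [y|[y|q]] //=; rewrite ?(ord1 p) ?(ord1 q) ?andbF.
Qed.

Lemma dumbbell_path_iso m l n :
  chromsym (clique_bridge (@ord0 m) (lollipop_end n l.+1)) =
  chromsym (dumbbell_path m.+1 l.+1 n.+1).
Proof.
pose f (z : 'I_m.+1 + ('I_n + 'I_l.+2)) : 'I_m.+1 + ('I_l.+1 + 'I_n.+1) :=
  match z with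
  | inl x => inl x
  | inr (inl y) => inr (inr (lift ord0 y))
  | inr (inr p) => inr (oapp inl (inr ord0) (unlift ord_max p))
  end.
pose g (z : 'I_m.+1 + ('I_l.+1 + 'I_n.+1)) : 'I_m.+1 + ('I_n + 'I_l.+2) :=
  match z with
  | inl x => inl x
  | inr (inl p) => inr (inr (lift ord_max p))
  | inr (inr y) => inr (oapp inl (inr ord_max) (unlift ord0 y))
  end.
apply: (@chromsym_iso (clique_bridge (@ord0 m) (lollipop_end n l.+1))
  (dumbbell_path m.+1 l.+1 n.+1) f).
  exists g => [[x|[y|p]]|[x|[p|y]]] //=; rewrite ?liftK ?unlift_none //.
    by case: unliftP => [j|] -> //=; rewrite unlift_none.
  by case: unliftP => [j|] -> //=; rewrite unlift_none.
have lift_neq i : (lift ord_max i == ord_max :> 'I_l.+2) = false.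
  by rewrite eq_sym; apply: negbTE (neq_lift _ _).
have root q : (inr q == lollipop_end n l.+1) = (q == 0%N :> nat) by [].
move=> [x|[x|p]] [y|[y|q]] //=; rewrite ?andbF ?root //.
- by case: (unliftP ord_max q) => [j|] ->; rewrite ?lift_max /= ?andbF.
- by case: (unliftP ord_max q) => [j|] ->; rewrite ?lift_neq /= ?andbF ?eqxx.
- by case: (unliftP ord_max p) => [i|] ->; rewrite ?lift_max /= ?andbF.
- by case: (unliftP ord_max p) => [i|] ->; rewrite ?lift_neq /= ?andbF ?eqxx.
case: (unliftP ord_max p) => [i|] ->; case: (unliftP ord_max q) => [j|] ->;
  rewrite /path_rel ?lift_max /= ?andbT ?eqxx //.
- by rewrite [_ == i :> nat]gtn_eqF ?orbF // ltnS ltnW.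
- by rewrite [_ == j :> nat]gtn_eqF // ltnS ltnW.
by rewrite /complete_rel eqxx gtn_eqF.
Qed.

(** Shifting the length to [t = l + 1] makes the three shapes of dumbbells
  instances of one family, [t] being the number of edges between the cliques. *)
Lemma chromsym_dumbbell m t n :
  chromsym (dumbbell m.+1 (t%:Z - 1) n.+1) =
  chromsym (clique_cone m (lollipop_end n t)).
Proof.
case: t => [|t]; first exact/esym/dumbbell_shared_iso.
rewrite -(clique_bridge_pendant m (lollipop_pendant n t)).
have -> : t.+1%:Z - 1 = t by lia.
case: t => [|l]; first exact/esym/dumbbell0_iso.
exact/esym/dumbbell_path_iso.
Qed.

Lemma lollipop_expansion n t :
  (n`!%:R)^-1 *: chromsym (lollipop n t) =
  clique_transform (fun s => chromsym (Pgraph s.+1)) n t.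
Proof. exact: (clique_cone_expansion path_pendant). Qed.

(* The orders of the paths are nonnegative integers: m + l + n >= 5,
   n + l + i >= 3, m + l + j >= 3 and l + i + j >= 1. *)
Theorem theorem4p11 (m n : nat) (l : int)
    (hm : (3 <= m)%N) (hn : (3 <= n)%N) (hl : -1 <= l) :
  (((m - 1)`!)%:R * ((n - 1)`!)%:R)^-1 *: chromsym (dumbbell m l n) =
    chromsym (Pgraph (absz (m%:Z + l + n%:Z)%R))
    - \sum_(1 <= i < m.-1)
        (((m - i - 1)%N)%:R / ((m - i)`!)%:R) *:
          (chromsym (Kgraph (m - i)) * chromsym (Pgraph (absz (n%:Z + l + i%:Z)%R)))
    - \sum_(1 <= j < n.-1)
        (((n - j - 1)%N)%:R / ((n - j)`!)%:R) *:
          (chromsym (Kgraph (n - j)) * chromsym (Pgraph (absz (m%:Z + l + j%:Z)%R)))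
    + \sum_(1 <= i < m.-1) \sum_(1 <= j < n.-1)
        (((m - i - 1)%N%:R * (n - j - 1)%N%:R) / (((m - i)`!)%:R * ((n - j)`!)%:R)) *:
          (chromsym (Kgraph (m - i)) * chromsym (Kgraph (n - j)) *
           chromsym (Pgraph (absz (l + i%:Z + j%:Z)%R))).
Proof.
case: m hm => // m hm; case: n hn => // n hn.
have [t ->] : exists t : nat, l = t%:Z - 1 by exists (absz (l + 1)); lia.
rewrite !subSS !subn0 chromsym_dumbbell invfM -scalerA scalerA mulrC -scalerA.
rewrite (clique_cone_expansion (lollipop_pendant n)) clique_transformZ.
have -> : (fun s => (n`!%:R)^-1 *: chromsym (lollipop n s)) =
    clique_transform (fun s => chromsym (Pgraph s.+1)) n.
  by apply: boolp.funext => s; apply: lollipop_expansion.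
(* The sum over [i] stays folded: only its inner transform yields both the
   single sum over [i] and the double sum. *)
rewrite !clique_transformE.
have pathE k k' : k = k' -> chromsym (Pgraph k) = chromsym (Pgraph k') by move=> ->.
rewrite [in RHS](addrAC (chromsym _)) -[RHS]addrA [X in _ = _ + X]addrC.
rewrite -[X in _ = _ + X]opprB -sumrB; congr (_ - _ - _).
- by apply: pathE; lia.
- apply: eq_big_nat => j /andP[j_gt0 _].
  by congr (_ *: (_ * _)); apply: pathE; lia.
apply: eq_big_nat => i /andP[i_gt0 _].
rewrite clique_transformE mulrBr scalerBr mulr_sumr scaler_sumr.
congr (_ - _); first by congr (_ *: (_ * _)); apply: pathE; lia.
apply: eq_big_nat => j /andP[j_gt0 _].
rewrite -scalerAr scalerA mulf_div mulrA; congr (_ *: (_ * _)).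
by apply: pathE; lia.
Qed.
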